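(* Let $G=(V,E)$ be a finite bipartite graph and let $u,v\in V$ be two vertices of $G$. Let $$\Delta(G,u,v)=\sigma(G_{-u})\cdot\sigma(G_{-v})-\sigma(G)\cdot\sigma(G_{-u-v}).$$ Then $$\Delta(G,u,v)\ \begin{cases}<0 & \text{if } d_G(u,v)\text{ is even},\\ =0 & \text{if } d_G(u,v)\text{ is infinite},\\ >0 & \text{if } d_G(u,v)\text{ is odd}.\end{cases}$$
   Context: Graphs are finite and simple (undirected, no loops or multiple edges). $\sigma(G)$ denotes the number of independent vertex sets of $G$, i.e. the number of subsets $W\subseteq V$ (including $W=\emptyset$) such that no two vertices of $W$ are adjacent; the empty graph (no vertices) has $\sigma=1$. $G_{-w}$ is the graph obtained from $G$ by removing the vertex $w$ and its incident edges; $G_{-u-v}$ is obtained by removing all vertices of the set $\{u,v\}$ and their incident edges (so if $u=v$ it equals $G_{-u}$). $d_G(u,v)$ is the distance of $u$ and $v$ in $G$, i.e. the minimum number of edges of a path from $u$ to $v$ (it is $0$, hence even, if $u=v$), and is infinite if there is no such path. *)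

(* Defs.v *)
From mathcomp Require Import all_boot all_order all_algebra.

Set Implicit Arguments.
Unset Strict Implicit.
Unset Printing Implicit Defensive.

Import GRing.Theory Num.Theory.

Record sgraph := SGraph {
  vertex :> finType;
  adj : rel vertex;
  adj_sym : symmetric adj;
  adj_irr : irreflexive adj }.

Definition independent (G : sgraph) (W : {set G}) : bool :=
  [forall x in W, forall y in W, ~~ adj x y].

Definition sigma (G : sgraph) : nat := #|[set W : {set G} | independent W]|.

Definition bipartite (G : sgraph) : Prop :=
  exists A B : {set G},
    [/\ A :|: B = [set: G], [disjoint A & B], independent A & independent B].

Section Deletion.

Variables (G : sgraph) (S : {set G}).

Definition del_adj : rel {x : G | x \notin S} :=
  fun x y => adj (val x) (val y).

Fact del_adj_sym : symmetric del_adj.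
Proof. by move=> x y; apply: adj_sym. Qed.

Fact del_adj_irr : irreflexive del_adj.
Proof. by move=> x; apply: adj_irr. Qed.

Definition del : sgraph := SGraph del_adj_sym del_adj_irr.

End Deletion.

Section Distance.

Variable G : sgraph.

Definition has_path (u v : G) (n : nat) : bool :=
  [exists p : n.-tuple G, [&& path (@adj G) u p, uniq (u :: p) & last u p == v]].

Lemma has_pathP (u v : G) :
  reflect (exists n, has_path u v n) (connect (@adj G) u v).
Proof.
apply: (iffP connectP) => [[p + ->]|[n /existsP[p /and3P[pth _ /eqP<-]]]].
  case/shortenP=> q qpth quniq _.
  exists (size q); apply/existsP; exists (in_tuple q).
  by rewrite qpth quniq eqxx.
by exists p.
Qed.

(* None stands for an infinite distance. *)
Definition dist (u v : G) : option nat :=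
  if has_pathP u v is ReflectT uv then Some (ex_minn uv) else None.

Lemma dist_SomeP (u v : G) (n : nat) :
  dist u v = Some n <->
  has_path u v n /\ (forall m, has_path u v m -> n <= m).
Proof.
rewrite /dist; case: has_pathP => [uv|nuv].
  case: ex_minnP => k kP kmin; split=> [[<-] //|[nP nmin]].
  by congr Some; apply/eqP; rewrite eqn_leq kmin // nmin.
by split=> // -[nP _]; case: nuv; exists n.
Qed.

Lemma dist_NoneP (u v : G) :
  dist u v = None <-> forall n, ~~ has_path u v n.
Proof.
rewrite /dist; case: has_pathP => [[n nP]|nuv]; split=> //.
  by move/(_ n); rewrite nP.
by move=> _ n; apply/negP => nP; apply: nuv; exists n.
Qed.

End Distance.

Definition Delta (G : sgraph) (u v : G) : int :=
  ((sigma (del [set u]))%:Z * (sigma (del [set v]))%:Z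
   - (sigma G)%:Z * (sigma (del [set u; v]))%:Z)%R.

(* Main.v *)
Require Import Defs.
From mathcomp Require Import all_boot all_order all_algebra.
From mathcomp Require Import ring.

(** Fix a proper 2-colouring [c] of [G] and count independent sets inside a
    variable vertex set [S], writing [nindep S].  Instead of two vertices,
    compare a set [A] and a vertex [v] through

      [D(S, A, v) = nindep (S - A) * nindep (S - v)
                    - nindep S * nindep (S - v - A)],

    so that [Delta u v] is [D] for [S] the whole graph and [A = {u}].  Allowing
    a set [A] makes [D] stable under the deletion of a single vertex [w] of [S]:

    - if [w] is in [A], then [D(S, A, v)] is a combination with positive
      coefficients of [D(S - w, A - w, v)] and [D(S, {w}, v)]
      ([setDelta_split]);
    - if [w != v], then [D(S, {w}, v) = - D(S - w, N(w), v)], where [N(w)] is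
      the neighbourhood of [w] ([setDelta1_nbhd]); this comes from counting
      independent sets according to whether they contain [w];
    - [D(S, {v}, v) < 0] if [v] is in [S].

    When all of [A] has one colour, all of [N(w)] has the other one.  Hence the
    change of sign in the second identity agrees with the change of colour, and
    the two terms of the first identity never have opposite signs.  Induction
    on the size of [S] then shows that [D(S, A, v)] is nonpositive if [A] has
    the colour of [v] and nonnegative otherwise.  As no cancellation can occur,
    [D(S, A, v)] is nonzero exactly if some chain of these identities reaches
    the third one, and such a chain is a path in [S] from [A] to [v]
    ([setDelta_sign]).  Along a path of length [n] the colour changes [n] times,
    which turns the colours of [u] and [v] into the parity of their distance. *)

Set Implicit Arguments.
Unset Strict Implicit.
Unset Printing Implicit Defensive.

Import Order.TTheory GRing.Theory Num.Theory.

(** * Counting independent sets in a vertex set *)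

Lemma independentP (G : sgraph) (W : {set G}) :
  reflect {in W &, forall x y, ~~ adj x y} (independent W).
Proof.
apply: (iffP forall_inP) => [indW x y Wx Wy | indW x Wx].
  by have /forall_inP := indW x Wx; apply.
by apply/forall_inP => y Wy; apply: indW.
Qed.

Section BipartiteDelta.

Variable G : sgraph.
Implicit Types (S A W : {set G}) (u v w x y : G).

Definition indeps S : {set {set G}} :=
  [set W : {set G} | (W \subset S) && independent W].

Definition nindep S : nat := #|indeps S|.

Definition nbhd w : {set G} := [set x | adj w x].

Lemma nindep_gt0 S : 0 < nindep S.
Proof.
apply/card_gt0P; exists set0; rewrite inE sub0set /=.
by apply/independentP => x y; rewrite inE.
Qed.

Lemma nindep_rec S w : w \in S ->
  nindep S = nindep (S :\ w) + nindep ((S :\ w) :\: nbhd w).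
Proof.
move=> Sw; rewrite /nindep -(cardsID [set W : {set G} | w \in W]) addnC.
congr (_ + _).
  apply: eq_card => W; rewrite !inE subsetD1 andbC.
  by case: (W \subset S); rewrite //= andbC.
(* The independent sets that contain [w] are the sets [w |: W]. *)
rewrite -[RHS](card_in_imset (f := fun W => w |: W)); last first.
  move=> W1 W2; rewrite !inE => /andP[/subsetP sW1 _] /andP[/subsetP sW2 _].
  have nW1 : w \notin W1 by apply/negP => /sW1; rewrite !inE eqxx andbF.
  have nW2 : w \notin W2 by apply/negP => /sW2; rewrite !inE eqxx andbF.
  by move=> eqW; rewrite -(setU1K nW1) eqW setU1K.
apply: eq_card => W; apply/idP/imsetP.
  rewrite !inE => /andP[/andP[/subsetP sWS /independentP indW] Ww].
  exists (W :\ w); last by rewrite setD1K.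
  rewrite inE; apply/andP; split.
    apply/subsetP => x; rewrite !inE => /andP[-> Wx].
    by rewrite (indW w x) ?sWS.
  by apply/independentP => x y /setD1P[_ Wx] /setD1P[_ Wy]; apply: indW.
case=> W'; rewrite !inE => /andP[/subsetP sW' /independentP indW'] ->.
rewrite setU11 andbT; apply/andP; split.
  by apply/subsetP => x /setU1P[-> // | /sW']; rewrite !inE => /and3P[].
have nadj x : x \in W' -> ~~ adj w x by move/sW'; rewrite !inE => /andP[].
apply/independentP => x y /setU1P[-> | Wx] /setU1P[-> | Wy].
- by rewrite adj_irr.
- exact: nadj.
- by rewrite adj_sym nadj.
- exact: indW'.
Qed.

Lemma sigma_nindep : sigma G = nindep [set: G].
Proof. by apply: eq_card => W; rewrite !inE subsetT. Qed.

Lemma sigma_del_nindep A : sigma (del A) = nindep (~: A).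
Proof.
have valI : injective (val : del A -> G) by exact: val_inj.
rewrite /sigma -(card_imset _ (imset_inj valI)).
apply: eq_card => W; apply/imsetP/idP.
  case=> W'; rewrite !inE => /independentP indW' ->.
  apply/andP; split.
    by apply/subsetP => _ /imsetP[x _ ->]; rewrite inE (valP x).
  by apply/independentP => _ _ /imsetP[x Wx ->] /imsetP[y Wy ->]; apply: indW'.
rewrite !inE => /andP[/subsetP sWA /independentP indW].
exists [set x : del A | val x \in W].
  by rewrite inE; apply/independentP => x y; rewrite !inE; apply: indW.
apply/setP => x; apply/idP/imsetP => [Wx | [y]]; last by rewrite inE => ? ->.
have nAx : x \notin A by have := sWA _ Wx; rewrite inE.
by exists (Sub x nAx); rewrite ?inE /=.
Qed.

(** * Identities for the difference of products *)

Local Open Scope ring_scope.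

Definition setDelta S A v : int :=
  (nindep (S :\: A))%:Z * (nindep (S :\ v))%:Z
  - (nindep S)%:Z * (nindep ((S :\ v) :\: A))%:Z.

Lemma Delta_setDelta u v : Delta u v = setDelta [set: G] [set u] v.
Proof.
by rewrite /Delta /setDelta sigma_nindep !sigma_del_nindep !setTD setUC setCU
           setDE.
Qed.

(** Deleting [A] amounts to deleting [w], then the rest of [A]: for the ratio
    [r X = nindep X / nindep (X :\ v)], the sign of [setDelta S A v] compares
    [r (S :\: A)] with [r S], and [r (S :\ w)] is an intermediate value. *)
Lemma setDelta_split S A v w : w \in A ->
  (nindep (S :\ v :\ w))%:Z * setDelta S A v =
    (nindep (S :\ v))%:Z * setDelta (S :\ w) (A :\ w) v
    + (nindep ((S :\ v) :\: A))%:Z * setDelta S [set w] v.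
Proof.
move=> Aw.
have DA X : X :\ w :\: (A :\ w) = X :\: A by rewrite setDDl setD1K.
have DC : S :\ w :\ v = S :\ v :\ w by rewrite !setDDl setUC.
by rewrite /setDelta DA DC DA; ring.
Qed.

Lemma setDelta1_nbhd S v w : w \in S -> w != v ->
  setDelta S [set w] v = - setDelta (S :\ w) (nbhd w) v.
Proof.
move=> Sw wv; have Svw : w \in S :\ v by rewrite !inE wv.
have DC : S :\ w :\ v = S :\ v :\ w by rewrite !setDDl setUC.
rewrite /setDelta (nindep_rec Sw) (nindep_rec Svw) DC !PoszD; ring.
Qed.

Lemma setDelta_diag_lt0 S v : v \in S -> setDelta S [set v] v < 0.
Proof.
move=> Sv; rewrite /setDelta (nindep_rec Sv) [S :\ v :\ v]setDDl setUid.
rewrite -mulrBl PoszD opprD addNKr mulNr oppr_lt0.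
by rewrite mulr_gt0 // ltz_nat nindep_gt0.
Qed.

(** * Paths inside a vertex set *)

Definition linked S A v : Prop :=
  exists w p,
    [/\ w \in A, {subset w :: p <= S}, path (@adj G) w p & last w p = v].

Lemma linked_split S A v w : w \in A ->
  linked S A v <-> linked (S :\ w) (A :\ w) v \/ linked S [set w] v.
Proof.
move=> Aw; split.
  case=> x [p [Ax sp pp lp]].
  have [wp | nwp] := boolP (w \in x :: p).
    (* The part of the path that starts at [w] links [w] itself to [v]. *)
    right; case/splitPl: wp sp pp lp => p1 p2 lw sp.
    rewrite cat_path last_cat lw => /andP[_ pp2] lp.
    exists w, p2; split=> //; first exact: set11.
    move=> y; rewrite inE => /orP[/eqP -> | yp2].
      by apply: sp; rewrite -lw -cat_cons mem_cat mem_last.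
    by apply: sp; rewrite -cat_cons mem_cat yp2 orbT.
  left; exists x, p; split=> // [|y yp].
    by rewrite !inE Ax andbT; apply: contraNneq nwp => ->; apply: mem_head.
  by rewrite !inE sp // andbT; apply: contraNneq nwp => <-.
case=> [[x [p [/setD1P[_ Ax] sp pp lp]]] | [x [p [/set1P -> sp pp lp]]]].
  by exists x, p; split=> // y /sp /setD1P[].
by exists w, p.
Qed.

Lemma linked1_nbhd S v w : w \in S -> w != v ->
  linked S [set w] v <-> linked (S :\ w) (nbhd w) v.
Proof.
move=> Sw wv; split.
  case=> x [p [/set1P -> sp pp lp]].
  (* On a path without repetition, [w] does not occur after its start. *)
  case/shortenP: pp lp => q pq uq sq lq.
  case: q pq uq sq lq => [|y q] /=.
    by move=> _ _ _ e; rewrite e eqxx in wv.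
  case/andP=> wy pq /andP[nw _] sq lq.
  exists y, q; split=> //; first by rewrite inE.
  move=> z zq; rewrite !inE; apply/andP; split.
    by apply: contraNneq nw => <-.
  by apply: sp; rewrite inE sq ?orbT.
case=> y [q [/[!inE] wy sq pq lq]].
exists w, (y :: q); split=> //=; first exact: set11.
  by move=> z; rewrite inE => /orP[/eqP -> // | /sq /setD1P[]].
by rewrite wy.
Qed.

(** * Sign of the difference *)

(** Knowing when each of several quantities of one sign is nonzero decides when
    their sum is, because nothing cancels; this is why both facts are proved
    together. *)
Definition pos_iff (P : Prop) (x : int) : Prop := 0 <= x /\ (0 < x <-> P).

Lemma pos_iff_combine (P Q : Prop) (x y z a b d : int) :
  0 < a -> 0 < b -> 0 < d -> a * z = b * x + d * y ->
  pos_iff P x -> pos_iff Q y -> pos_iff (P \/ Q) z.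
Proof.
move=> a0 b0 d0 e [x0 Px] [y0 Qy].
have bx0 : 0 <= b * x by rewrite pmulr_rge0.
have dy0 : 0 <= d * y by rewrite pmulr_rge0.
split; first by rewrite -(pmulr_rge0 _ a0) e addr_ge0.
rewrite -(pmulr_rgt0 _ a0) e lt0r addr_ge0 // andbT paddr_eq0 //.
rewrite !mulf_eq0 !(gt_eqF a0, gt_eqF b0, gt_eqF d0) /= negb_and.
split.
  case/orP=> nz; [left; apply/Px | right; apply/Qy].
    by rewrite lt0r nz.
  by rewrite lt0r nz.
by case=> [/Px/lt0r_neq0 -> | /Qy/lt0r_neq0 ->]; rewrite ?orbT.
Qed.

(** The expected sign is [-1] if [A] has the colour of [v], and [1] otherwise.
    One colour [a] common to the whole of [A] is what keeps the two terms of
    [setDelta_split] on the same side of zero. *)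
Lemma setDelta_sign (c : G -> bool) S A v (a : bool) :
  (forall x y, adj x y -> c y = ~~ c x) -> {in A, forall x, c x = a} ->
  pos_iff (linked S A v) ((-1) ^+ (a == c v) * setDelta S A v).
Proof.
move=> c_adj; have [n] := ubnP #|S|.
elim: n S A a => // n IHn S A a ltSn cA.
have [w /setIP[Sw Aw] | AS0] := pickP (mem (S :&: A)); last first.
  have SDA (X : {set G}) : X \subset S -> X :\: A = X.
    move=> sXS; apply/setDidPl; rewrite disjoint_subset; apply/subsetP => x Xx.
    by have := AS0 x; rewrite !inE (subsetP sXS) //= => ->.
  rewrite /setDelta !SDA ?subD1set // subrr mulr0.
  split=> //; split=> // -[x [p [Ax /(_ _ (mem_head _ _)) Sx _ _]]].
  by have := AS0 x; rewrite !inE Sx Ax.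
have ltSwn : (#|S :\ w| < n)%N by move: ltSn; rewrite [#|S|](cardsD1 w) Sw.
have pos_split Q : pos_iff Q ((-1) ^+ (a == c v) * setDelta S [set w] v) ->
    pos_iff (linked (S :\ w) (A :\ w) v \/ Q)
            ((-1) ^+ (a == c v) * setDelta S A v).
  have nindepz_gt0 (X : {set G}) : 0 < (nindep X)%:Z :> int.
    by rewrite ltz_nat nindep_gt0.
  apply: (pos_iff_combine (nindepz_gt0 (S :\ v :\ w)) (nindepz_gt0 (S :\ v))
    (nindepz_gt0 ((S :\ v) :\: A)) _ (IHn (S :\ w) (A :\ w) a ltSwn _)).
    by rewrite mulrCA setDelta_split // mulrDr; congr (_ + _); rewrite mulrCA.
  by move=> x /setD1P[_]; apply: cA.
have {}pos_split : pos_iff (linked S [set w] v)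
    ((-1) ^+ (a == c v) * setDelta S [set w] v) ->
    pos_iff (linked S A v) ((-1) ^+ (a == c v) * setDelta S A v).
  case/pos_split=> ge0 gt0; split=> //.
  by apply: iff_trans gt0 _; apply: iff_sym; apply: linked_split.
apply: pos_split; have [wv | wv] := eqVneq w v.
  subst w; rewrite cA // eqxx mulN1r.
  have lt0 : 0 < - setDelta S [set v] v by rewrite oppr_gt0 setDelta_diag_lt0.
  split; first exact: ltW.
  split=> // _; exists v, [::]; split=> //; first exact: set11.
  by move=> x; rewrite inE => /eqP ->.
have cN : {in nbhd w, forall x, c x = ~~ a}.
  by move=> x; rewrite inE => /c_adj ->; rewrite cA.
have [ge0 gt0] := IHn _ _ _ ltSwn cN.
rewrite setDelta1_nbhd // mulrN -mulNr.
have -> : - (-1) ^+ (a == c v) = (-1) ^+ (~~ a == c v) :> int.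
  by case: (a) (c v) => [] [] //=; rewrite opprK.
split=> //; apply: iff_trans gt0 _.
by apply: iff_sym; apply: linked1_nbhd.
Qed.

(** * Colours and distances *)

Lemma colour_path (c : G -> bool) u p :
  (forall x y, adj x y -> c y = ~~ c x) -> path (@adj G) u p ->
  c (last u p) = c u (+) odd (size p).
Proof.
move=> c_adj; elim: p u => [|x p IHp] u /=; first by rewrite addbF.
by case/andP=> /c_adj cx /IHp ->; rewrite cx addNb addbN.
Qed.

Lemma bipartite_colouring :
  bipartite G -> exists c : G -> bool, forall x y, adj x y -> c y = ~~ c x.
Proof.
case=> A [B [AB dAB /independentP indA /independentP indB]].
have inB x : x \notin A -> x \in B.
  by move=> nAx; have := in_setT x; rewrite -AB inE (negPf nAx).
exists (mem A) => x y adjxy /=; case Ax: (x \in A) => /=.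
  by apply/negP => Ay; have := indA x y Ax Ay; rewrite adjxy.
apply: contraT => Ay; have := indB x y (inB _ (negbT Ax)) (inB _ Ay).
by rewrite adjxy.
Qed.

Lemma dist_Some_path u v n : dist u v = Some n ->
  exists p, [/\ path (@adj G) u p, last u p = v & size p = n].
Proof.
case/dist_SomeP=> /existsP[p /and3P[pp _ /eqP lp]] _.
by exists p; rewrite size_tuple.
Qed.

Lemma dist_None_linked u v : dist u v = None -> ~ linked [set: G] [set u] v.
Proof.
move/dist_NoneP => nop [x [p [/set1P -> _ pp lp]]].
have /has_pathP[n] : connect (@adj G) u v by apply/connectP; exists p.
exact/negP/nop.
Qed.

End BipartiteDelta.

Theorem corollary8 (G : sgraph) (u v : G) (bipG : bipartite G) :
  [/\ (forall n : nat, dist u v = Some n -> ~~ odd n -> (Delta u v < 0)%R),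
      (dist u v = None -> Delta u v = 0%R)
    & (forall n : nat, dist u v = Some n -> odd n -> (0 < Delta u v)%R)].
Proof.
have [c c_adj] := bipartite_colouring bipG.
have cu : {in [set u], forall x, c x = c u} by move=> x /set1P ->.
have [ge0 gt0] := setDelta_sign [set: G] v c_adj cu.
rewrite -Delta_setDelta in ge0 gt0.
have dist_gt0 n : dist u v = Some n -> (0 < (-1) ^+ (~~ odd n) * Delta u v)%R.
  case/dist_Some_path=> p [pp lp <-].
  have -> : ~~ odd (size p) = (c u == c v).
    by rewrite -lp (colour_path c_adj pp); case: (c u); case: (odd _).
  apply/gt0; exists u, p; split=> //; first exact: set11.
  by move=> x _; rewrite inE.
split=> [n /dist_gt0 + /negPf odd_n | /dist_None_linked unlinked |
         n /dist_gt0 + odd_n].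
- by rewrite odd_n mulN1r oppr_gt0.
- apply/eqP; have : ((-1) ^+ (c u == c v) * Delta u v == 0)%R.
    by rewrite eq_le ge0 andbT leNgt; apply/negP => /gt0.
  by rewrite mulf_eq0 signr_eq0.
- by rewrite odd_n mul1r.
Qed.
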